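(* Let $g:M\to M$ be a $C^2$ local diffeomorphism of a compact manifold $M$. Suppose there exists a compact $g$-invariant set $\Lambda\subset M$ such that $(g,\Lambda)$ has the shadowing by periodic points property. If $g$ is non uniformly expanding on the set $\mathrm{Per}(g)$ of periodic points of $g$, then $g$ is an expanding map on $\Lambda$.
   Context: Shadowing by periodic points property: for a map $f:M\to M$ and a compact $f$-invariant set $\hat\Lambda\subset M$, the pair $(f,\hat\Lambda)$ has this property if for every $\epsilon>0$ there exists $\alpha>0$ such that for any orbit segment $\{x,\dots,f^n(x)\}\subset\hat\Lambda$ with $d(f^n(x),x)<\alpha$ there exists a periodic point $p\in M$ with period $n$ (i.e. $f^n(p)=p$) such that $d(f^j(p),f^j(x))<\epsilon$ for all $0\le j\le n$. Non uniformly expanding (NUE): a $g$-invariant set $S\subset M$ is non uniformly expanding (equivalently, $g$ is non uniformly expanding on $S$) if there exist $\eta<0$ and a Riemannian metric on $M$ (an ''adapted'' metric) such that every $p\in S$ satisfies $$\liminf_{n\to+\infty}\frac1n\sum_{j=0}^{n-1}\log\|[Dg(g^j(p))]^{-1}\|\le\eta .$$ Expanding on $\Lambda$: there are $c>0$ and $\sigma>1$ with $\|Dg^n(x)v\|\ge c\,\sigma^n\|v\|$ for all $x\in\Lambda$, $v\in T_xM$, $n\in\mathbb{N}$. *)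

(* Defs.v *)
From HB Require Import structures.
From mathcomp Require Import all_boot all_order all_algebra.
From mathcomp Require Import all_classical all_reals all_analysis.
Set Implicit Arguments. Unset Strict Implicit. Unset Printing Implicit Defensive.
Import Order.TTheory GRing.Theory Num.Theory.
Import numFieldNormedType.Exports.
Local Open Scope classical_set_scope.
Local Open Scope ring_scope.

(** [f] is of class C^k at every point of the (open) set [U]. *)
Fixpoint Ck_on {R : realType} {n : nat} {W : normedModType R} (k : nat)
    (U : set 'rV[R]_n) (f : 'rV[R]_n -> W) {struct k} : Prop :=
  match k with
  | 0 => forall x, U x -> {for x, continuous f}
  | k'.+1 => (forall x, U x -> differentiable f x) /\
             (forall v : 'rV[R]_n, Ck_on k' U (fun x => 'D_v f x))
  end.

(** Smooth n-dimensional manifold structure without boundary on [M].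
    A chart [c] is the homeomorphism [coord c] from the open set [dom c] onto
    the open set [coord c @` dom c]; [coord c] and its inverse [param c] are
    total functions whose values outside these sets are irrelevant.
    [chart_at] picks a chart around each point; it serves to represent
    tangent vectors, see below. *)
Record smooth_manifold (R : realType) (n : nat) (M : topologicalType) := {
  chart : Type;
  dom : chart -> set M;
  coord : chart -> M -> 'rV[R]_n;
  param : chart -> 'rV[R]_n -> M;
  open_dom : forall c, open (dom c);
  open_coord_dom : forall c, open (coord c @` dom c);
  coordK : forall c x, dom c x -> param c (coord c x) = x;
  coord_continuous : forall c x, dom c x -> {for x, continuous (coord c)};
  param_continuous : forall c y, (coord c @` dom c) y ->
    {for y, continuous (param c)};
  transition_smooth : forall c c' k,
    Ck_on k (coord c @` (dom c `&` dom c')) (coord c' \o param c);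
  chart_at : M -> chart;
  dom_chart_at : forall x, dom (chart_at x) x
}.

Definition Ck_map_on {R : realType} {n : nat} {M : topologicalType}
    (A : smooth_manifold R n M) (k : nat) (U : set M) (f : M -> M) : Prop :=
  (forall x, U x -> {for x, continuous f}) /\
  (forall c c' : chart A,
     Ck_on k (coord c @` (U `&` dom c `&` f @^-1` dom c'))
       (coord c' \o f \o param c)).

Definition Ck_local_diffeo {R : realType} {n : nat} {M : topologicalType}
    (A : smooth_manifold R n M) (k : nat) (f : M -> M) : Prop :=
  forall x, exists (U : set M) (h : M -> M),
    [/\ open U, U x, open (f @` U), (forall y, U y -> h (f y) = y)
      & Ck_map_on A k U f /\ Ck_map_on A k (f @` U) h].

(** The tangent space at [x] is ['rV[R]_n]: a tangent vector is identified with
    its components in the chart [chart_at x].  The derivative of [f] at [x],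
    from the tangent space at [x] to the one at [f x], is then the Jacobian of
    [f] read in the charts [chart_at x] and [chart_at (f x)]; it acts on row
    vectors on the right, [v |-> v *m tangent A f x]. *)
Definition tangent {R : realType} {n : nat} {M : topologicalType}
    (A : smooth_manifold R n M) (f : M -> M) (x : M) : 'M[R]_n :=
  'J (coord (chart_at A (f x)) \o f \o param (chart_at A x))
     (coord (chart_at A x) x).

(** [gram x] is the Gram matrix of the inner product on the tangent space at
    [x].  In [gram_smooth], the rows of [J] are the coordinate vector fields of
    the chart [c], so that the entries of [J *m gram x *m J^T] are the
    components g_ij of the metric in the chart [c]. *)
Record riemannian_metric {R : realType} {n : nat} {M : topologicalType}
    (A : smooth_manifold R n M) := {
  gram : M -> 'M[R]_n;
  gram_sym : forall x, (gram x)^T = gram x;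
  gram_gt0 : forall x (v : 'rV[R]_n), v != 0 ->
    0 < (v *m gram x *m v^T) 0 0;
  gram_smooth : forall (c : chart A) (k : nat),
    Ck_on k (coord c @` dom c)
      (fun y => let x := param c y in
                let J := 'J (coord (chart_at A x) \o param c) y in
                J *m gram x *m J^T)
}.

Section Dynamics.
Context {R : realType} {n : nat} {M : topologicalType}.
Context {A : smooth_manifold R n M}.

Definition tnorm (G : riemannian_metric A) (x : M) (v : 'rV[R]_n) : R :=
  Num.sqrt ((v *m gram G x *m v^T) 0 0).

(** Operator norm of a linear map from the tangent space at [x] to the one
    at [y]. *)
Definition topnorm (G : riemannian_metric A) (x y : M) (B : 'M[R]_n) : R :=
  sup [set tnorm G y (v *m B) | v in [set v | tnorm G x v <= 1]].

(** The logarithm is the extended one, [lne 0 = -oo]; this only matters in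
    dimension 0, where the norm of every operator is 0. *)
Definition non_uniformly_expanding (g : M -> M) (S : set M) : Prop :=
  exists (eta : R) (G : riemannian_metric A), eta < 0 /\
    forall p, S p ->
      (limn_einf (fun k : nat =>
        (k%:R^-1)%:E * \sum_(0 <= j < k)
          lne (topnorm G (g (iter j g p)) (iter j g p)
                 (invmx (tangent A g (iter j g p))))%:E) <= eta%:E)%E.

Definition expanding_on (G : riemannian_metric A) (g : M -> M) (L : set M) :
    Prop :=
  exists c sigma : R, [/\ 0 < c, 1 < sigma &
    forall x, L x -> forall (v : 'rV[R]_n) (k : nat),
      c * sigma ^+ k * tnorm G x v
        <= tnorm G (iter k g x) (v *m tangent A (iter k g) x)].

End Dynamics.
Arguments non_uniformly_expanding {R n M} A g S.

Definition periodic_points {T : Type} (g : T -> T) : set T :=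
  [set p | exists2 k : nat, (0 < k)%N & iter k g p = p].

Definition periodic_shadowing {R : realType} {M : metricType R}
    (f : M -> M) (L : set M) : Prop :=
  forall e : R, 0 < e -> exists2 a : R, 0 < a &
    forall (x : M) (k : nat), (0 < k)%N ->
      (forall j, (j <= k)%N -> L (iter j f x)) ->
      mdist (iter k f x) x < a ->
      exists2 p : M, iter k f p = p &
        forall j, (j <= k)%N -> mdist (iter j f p) (iter j f x) < e.

(* Main.v *)
(** With phi x = log |[Dg(x)]^-1| in the adapted metric, phi is continuous and
    its Birkhoff sums over periodic orbits of period k are at most k eta.  By
    shadowing and uniform continuity, orbit segments of L of length k that
    return close to their starting point have Birkhoff sum at most k eta / 2.
    Ergodic theory can be avoided at this point: cover L by N small cells and
    cut an arbitrary orbit segment of L greedily into at most N such loops,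
    each followed by one step, which gives the bound K + k eta / 2.  Hence
    |[Dg^k(x)]^-1| <= e^K e^(k eta / 2) on L, and any other Riemannian metric
    is uniformly equivalent to the adapted one by compactness of M. *)
Require Import Defs.
From HB Require Import structures.
From mathcomp Require Import all_boot all_order all_algebra.
From mathcomp Require Import all_classical all_reals all_analysis.
From mathcomp Require Import ring lra.
Import Order.TTheory GRing.Theory Num.Theory.
Import numFieldNormedType.Exports.
Local Open Scope classical_set_scope.
Local Open Scope ring_scope.

Set Implicit Arguments.
Unset Strict Implicit.
Unset Printing Implicit Defensive.

(** * Jacobians: locality and the chain rule *)

(** The first-order expansion of [f] at [a] is also one for [h], and differentials are unique. Chart
    expressions agree only near a point, so this locality is needed throughout. *)
Lemma near_eq_differentiable (R : realType) (V W : normedModType R)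
    (f h : V -> W) (a : V) :
  (\forall y \near a, f y = h y) -> differentiable f a -> differentiable h a.
Proof.
move=> fh df; have dh : h \o shift a = cst (h a) + 'd f a +o_ 0 id.
  apply/eqaddoP => _/posnumP[e].
  have fh0 : \forall y \near (0 : V), f (y + a) = h (y + a).
    by move: fh; rewrite (near_shift 0) /=; apply: filterS => y; rewrite subr0.
  have /eqaddoP/(_ e%:num) := diff_locally df; move=> /(_ [gt0 of e%:num]).
  by apply: filterS2 fh0 => y; rewrite !fctE /= (nbhs_singleton fh) => ->.
have d_h := diff_unique (diff_continuous df) dh.
by apply/diff_locallyP; rewrite d_h; split => //; exact: diff_continuous.
Qed.

Lemma row_jacobian (R : realType) (m n : nat) (f : 'rV[R]_m -> 'rV[R]_n)
    (a : 'rV[R]_m) (i : 'I_m) :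
  differentiable f a -> row i ('J f a) = 'D_(delta_mx 0 i) f a.
Proof. by move=> df; rewrite rowE -deriveEjacobian. Qed.

Lemma near_eq_jacobian (R : realType) (m n : nat) (f h : 'rV[R]_m -> 'rV[R]_n)
    (a : 'rV[R]_m) :
  (\forall y \near a, f y = h y) -> differentiable f a -> 'J h a = 'J f a.
Proof.
move=> fh df; apply/row_matrixP => i.
apply: etrans (row_jacobian i (near_eq_differentiable fh df)) _.
apply: etrans _ (esym (row_jacobian i df)).
by apply/esym; exact: near_eq_derive.
Qed.

Lemma jacobian_comp (R : realType) (m n p : nat) (f : 'rV[R]_m -> 'rV[R]_n)
    (h : 'rV[R]_n -> 'rV[R]_p) (a : 'rV[R]_m) :
  differentiable f a -> differentiable h (f a) ->
  'J (h \o f) a = 'J f a *m 'J h (f a).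
Proof.
move=> df dh; have dhf := differentiable_comp df dh.
apply/row_matrixP => i; apply: etrans (row_jacobian i dhf) _.
rewrite row_mul (row_jacobian i df).
apply: etrans _ (deriveEjacobian _ dh).
by rewrite (deriveE _ dhf) (deriveE _ dh) diff_comp//= (deriveE _ df).
Qed.

Lemma jacobian_id (R : realType) (m : nat) (a : 'rV[R]_m) : 'J id a = 1%:M.
Proof.
apply/row_matrixP => i; apply: etrans (row_jacobian i _) _ => //.
by rewrite deriveE// diff_val rowE mulmx1.
Qed.

Lemma near_eq_continuous_for (T U : topologicalType) (f h : T -> U) (x : T) :
  (\forall y \near x, f y = h y) -> {for x, continuous f} ->
  {for x, continuous h}.
Proof.
move=> fh cf; rewrite /prop_for /continuous_at -(nbhs_singleton fh).
exact: cvg_trans (near_eq_cvg fh) cf.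
Qed.

(** * Derivatives in charts *)

Section ChartCalculus.
Context {R : realType} {n : nat} {M : topologicalType}.
Variable A : smooth_manifold R n M.
Implicit Types (a b c : chart A) (f h : M -> M) (x y : M).

Definition rep a b f : 'rV[R]_n -> 'rV[R]_n := Defs.coord b \o f \o param a.

Definition jac a b f y : 'M[R]_n := 'J (rep a b f) (Defs.coord a y).

(** Continuity is demanded separately: without it [f] could leave [dom b] arbitrarily close to [y],
    where [rep a b f] reads irrelevant values of [coord b]. *)
Definition dmap f y : Prop :=
  {for y, continuous f} /\ forall a b, dom a y -> dom b (f y) ->
    differentiable (rep a b f) (Defs.coord a y).

Lemma near_dom a y : dom a y -> \forall z \near y, dom a z.
Proof. by move=> ay; apply: open_nbhs_nbhs; split => //; exact: open_dom. Qed.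

Lemma near_param a y (U : set M) : dom a y -> nbhs y U ->
  \forall u \near Defs.coord a y, U (param a u).
Proof.
move=> ay Uy; have := @param_continuous _ _ _ A a (Defs.coord a y).
move=> /(_ (imageP _ ay)); rewrite /prop_for /continuous_at coordK//.
exact.
Qed.

Lemma rep_coord a b f y : dom a y ->
  rep a b f (Defs.coord a y) = Defs.coord b (f y).
Proof. by move=> ay; rewrite /rep /= coordK. Qed.

Lemma near_eq_rep a b f h y : dom a y -> (\forall z \near y, f z = h z) ->
  \forall u \near Defs.coord a y, rep a b f u = rep a b h u.
Proof.
by move=> ay fh; apply: filterS (near_param ay fh) => u; rewrite /rep /= => ->.
Qed.

Lemma near_eq_jac a b f h y : dom a y -> dom b (f y) ->
  (\forall z \near y, f z = h z) -> dmap f y -> jac a b h y = jac a b f y.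
Proof.
move=> ay bfy fh [_ df].
by apply: near_eq_jacobian; [exact: near_eq_rep | exact: df].
Qed.

(** By continuity [f] stays in [dom b] near [y], and there the intermediate chart [b] cancels. *)
Lemma near_rep_comp a b c f h y : dom a y -> dom b (f y) ->
  {for y, continuous f} ->
  \forall u \near Defs.coord a y,
    (rep b c h \o rep a b f) u = rep a c (h \o f) u.
Proof.
move=> ay bfy cf.
have bf : \forall z \near y, dom b (f z) by exact: cf _ (near_dom bfy).
by apply: filterS (near_param ay bf) => u bu; rewrite /rep /= coordK.
Qed.

Lemma dmap_comp f h y : dmap f y -> dmap h (f y) -> dmap (h \o f) y.
Proof.
move=> [cf df] [ch dh]; split; first exact: continuous_comp.
move=> a c ay chy; pose b := chart_at A (f y).
have bfy : dom b (f y) by exact: dom_chart_at.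
apply: near_eq_differentiable (near_rep_comp c h ay bfy cf) _.
apply: differentiable_comp; first exact: df.
by rewrite rep_coord//; exact: dh.
Qed.

Lemma jac_comp a b c f h y : dmap f y -> dmap h (f y) ->
  dom a y -> dom b (f y) -> dom c (h (f y)) ->
  jac a c (h \o f) y = jac a b f y *m jac b c h (f y).
Proof.
move=> [cf df] [ch dh] ay bfy chy; have dfy := df _ _ ay bfy.
have dhy : differentiable (rep b c h) (rep a b f (Defs.coord a y)).
  by rewrite rep_coord//; exact: dh.
apply: etrans (near_eq_jacobian (near_rep_comp c h ay bfy cf) _) _.
  exact: differentiable_comp.
by apply: etrans (jacobian_comp dfy dhy) _; rewrite rep_coord.
Qed.

(** Read in two charts, the identity is a transition map, and these are smooth. *)
Lemma dmap_id y : dmap idfun y.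
Proof.
split; first exact: cvg_id.
move=> a b ay biy; have [d _] := transition_smooth a b 1.
by apply: d; exists y.
Qed.

Lemma jac_id a y : dom a y -> jac a a idfun y = 1%:M.
Proof.
move=> ay; apply: etrans (jacobian_id (Defs.coord a y)).
apply: near_eq_jacobian => //.
have : nbhs (Defs.coord a y) (Defs.coord a @` dom a).
  by apply: open_nbhs_nbhs; split; [exact: open_coord_dom | exact: imageP].
by apply: filterS => _ [z az <-]; rewrite rep_coord.
Qed.

(** Chain rule for [h \o f], which is the identity near [y]. It makes the Jacobians of local
    diffeomorphisms and of chart changes invertible. *)
Lemma jac_left_inverse a b f h y : dmap f y -> dmap h (f y) ->
  (\forall z \near y, h (f z) = z) -> dom a y -> dom b (f y) ->
  jac a b f y *m jac b a h (f y) = 1%:M.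
Proof.
move=> df dh hf ay bfy; have hfy := nbhs_singleton hf.
have ahfy : dom a (h (f y)) by rewrite hfy.
apply: etrans (esym (jac_comp df dh ay bfy ahfy)) _.
apply: etrans _ (jac_id ay).
by apply: near_eq_jac => //; [apply: filterS hf | exact: dmap_id].
Qed.

Lemma Ck_local_diffeo_dmap k f y : Ck_local_diffeo A k.+1 f -> dmap f y.
Proof.
move=> /(_ y) [U [h [oU Uy _ _ [[cf df] _]]]]; split; first exact: cf.
move=> a b ay bfy; have [d _] := df a b.
by apply: d; exists y.
Qed.

Lemma Ck_local_diffeo_inverse k f y : Ck_local_diffeo A k.+1 f ->
  exists2 h : M -> M, dmap h (f y) & \forall z \near y, h (f z) = z.
Proof.
move=> /(_ y) [U [h [oU Uy ofU hf [_ [ch dh]]]]]; exists h; last first.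
  by apply: filterS (open_nbhs_nbhs (conj oU Uy)) => z Uz; exact: hf.
have fUy : (f @` U) (f y) by exact: imageP.
split; first exact: ch.
move=> a b ay bfy; have [d _] := dh a b.
by apply: d; exists (f y).
Qed.

Lemma Ck_local_diffeo_jac_continuous k f x a b i j :
  Ck_local_diffeo A k.+2 f -> dom a x -> dom b (f x) ->
  {for x, continuous (fun y => jac a b f y i j)}.
Proof.
move=> kf ax bfx; have [cfx _] := @Ck_local_diffeo_dmap _ f x kf.
pose v : 'rV[R]_n := delta_mx 0 i.
have [U [h [oU Ux _ _ [[cf /(_ a b) [df /(_ v) [d2 _]]] _]]]] := kf x.
apply: (@near_eq_continuous_for _ _
  (fun y => ('D_v (rep a b f) (Defs.coord a y)) 0 j)).
  have bf : \forall z \near x, dom b (f z) by exact: cfx _ (near_dom bfx).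
  have UU := open_nbhs_nbhs (conj oU Ux).
  apply: filterS3 bf UU (near_dom ax) => z bz Uz az.
  have e : row i (jac a b f z) = 'D_v (rep a b f) (Defs.coord a z).
    by apply: row_jacobian; apply: df; exists z.
  by apply: etrans (congr1 (fun r : 'rV[R]_n => r 0 j) (esym e)) _; rewrite mxE.
apply: (@continuous_comp _ _ _ (Defs.coord a)
  (fun w => ('D_v (rep a b f) w : 'rV[R]_n) 0 j)).
  exact: Defs.coord_continuous.
apply: (@continuous_comp _ _ _ ('D_v (rep a b f)) (fun w : 'rV[R]_n => w 0 j)).
  by apply: differentiable_continuous; apply: d2; exists x.
exact: matrix_normedtype.coord_continuous.
Qed.

End ChartCalculus.

Lemma continuous_for_sum (R : realType) (T : topologicalType) (I : Type)
    (r : seq I) (F : I -> T -> R) (x : T) :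
  (forall i, {for x, continuous (F i)}) ->
  {for x, continuous (fun y => \sum_(i <- r) F i y)}.
Proof.
move=> cF; rewrite /prop_for /continuous_at; elim: r => [|i r IH].
  by under eq_fun do rewrite big_nil; rewrite big_nil; exact: cst_continuous.
under eq_fun do rewrite big_cons; rewrite big_cons.
exact: continuousD (cF i) IH.
Qed.

(** * Quadratic forms *)

Section QuadraticForms.
Context {R : realType} {n : nat}.
Implicit Types (E F : 'M[R]_n) (v w : 'rV[R]_n).

Definition qform E v : R := (v *m E *m v^T) 0 0.

Definition qnorm E v : R := Num.sqrt (qform E v).

Definition posdef E : Prop := forall v, v != 0 -> 0 < qform E v.

Lemma qform_sum E v : qform E v = \sum_j \sum_i v 0 i * E i j * v 0 j.
Proof.
by rewrite /qform mxE; apply: eq_bigr => j _; rewrite !mxE mulr_suml.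
Qed.

Lemma qform_mul E (B : 'M[R]_n) v : qform E (v *m B) = qform (B *m E *m B^T) v.
Proof. by rewrite /qform trmx_mul !mulmxA. Qed.

Lemma qnorm_mul E (B : 'M[R]_n) v : qnorm E (v *m B) = qnorm (B *m E *m B^T) v.
Proof. by rewrite /qnorm qform_mul. Qed.

Lemma qformZ E (k : R) v : qform E (k *: v) = k ^+ 2 * qform E v.
Proof.
by rewrite /qform linearZ /= -!scalemxAl -scalemxAr scalerA !mxE expr2.
Qed.

Lemma qformB E F v : qform (E - F) v = qform E v - qform F v.
Proof. by rewrite /qform mulmxBr mulmxBl !mxE. Qed.

Lemma qform0 E : qform E 0 = 0.
Proof. by rewrite /qform !mul0mx mxE. Qed.

Lemma qnorm0 E : qnorm E 0 = 0.
Proof. by rewrite /qnorm qform0 sqrtr0. Qed.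

Lemma qnormZ E (k : R) v : qnorm E (k *: v) = `|k| * qnorm E v.
Proof. by rewrite /qnorm qformZ sqrtrM ?sqr_ge0// sqrtr_sqr. Qed.

Lemma qnorm_ge0 E v : 0 <= qnorm E v.
Proof. exact: sqrtr_ge0. Qed.

Lemma posdef_ge0 E v : posdef E -> 0 <= qform E v.
Proof.
move=> pE; have [->|v0] := eqVneq v 0; first by rewrite qform0.
exact/ltW/pE.
Qed.

Lemma posdef_qnorm_gt0 E v : posdef E -> v != 0 -> 0 < qnorm E v.
Proof. by move=> pE v0; rewrite sqrtr_gt0; exact: pE. Qed.

Lemma posdef_mul E (B : 'M[R]_n) : posdef E -> B \in unitmx ->
  posdef (B *m E *m B^T).
Proof.
move=> pE uB v v0; rewrite -qform_mul; apply: pE.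
by apply: contraNneq v0 => vB0; rewrite -(mulmxK uB v) vB0 mul0mx.
Qed.

Lemma ler_entry_norm v i : `|v 0 i| <= `|v|.
Proof.
rewrite [leRHS]mx_normrE; exact: (le_bigmax _ (fun k => `|v k.1 k.2|) (0, i)).
Qed.

Lemma ler_norm_qform E (e : R) v : (forall i j, `|E i j| <= e) ->
  `|qform E v| <= n%:R ^+ 2 * e * `|v| ^+ 2.
Proof.
move=> Ee; rewrite qform_sum; apply: le_trans (ler_norm_sum _ _ _) _.
have -> : n%:R ^+ 2 * e * `|v| ^+ 2 = \sum_(j < n) \sum_(i < n) `|v| * e * `|v|.
  by rewrite !sumr_const !card_ord -mulrnA -[RHS]mulr_natl natrM; ring.
apply: ler_sum => j _; apply: le_trans (ler_norm_sum _ _ _) _.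
apply: ler_sum => i _; rewrite !normrM.
by rewrite !ler_pM// ?mulr_ge0//; exact: ler_entry_norm.
Qed.

Lemma qform_continuous E : continuous (qform E).
Proof.
move=> v; rewrite (_ : qform E = fun v => \sum_j \sum_i v 0 i * E i j * v 0 j);
  last by apply/funext => w; exact: qform_sum.
apply: continuous_for_sum => j; apply: continuous_for_sum => i.
apply: continuousM; last exact: coord_continuous.
apply: continuousM; first exact: coord_continuous.
exact: cst_continuous.
Qed.

(** The form has a minimum on the compact unit sphere, positive by definiteness; homogeneity of
    degree two carries the bound to all vectors. *)
Lemma posdef_lower_bound E : posdef E ->
  exists2 l : R, 0 < l & forall v, l * `|v| ^+ 2 <= qform E v.
Proof.
move=> pE; pose S := [set v : 'rV[R]_n | `|v| = 1].
have unitS v : v != 0 -> S (`|v|^-1 *: v).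
  by move=> v0; rewrite /S /= normrZ normfV normr_id mulVf// normr_eq0.
have [S0|/nonemptyPn S0] := pselect (S !=set0); last first.
  (* An empty unit sphere means that all vectors are zero, so any constant serves. *)
  exists 1 => // v; have [->|/unitS] := eqVneq v 0.
    by rewrite qform0 normr0 expr0n mulr0.
  by rewrite S0.
have cS : compact S.
  apply: bounded_closed_compact.
    by exists 1; split => // K K1 v /= ->; exact: ltW.
  apply: (@preimage_closed _ _ (fun v : 'rV[R]_n => `|v|) [set x | x = 1]).
    by move=> v _; exact: norm_continuous.
  exact: closed_eq.
have [v0 /set_mem Sv0 minv0] := EVT_min_rV S0 cS
  (continuous_subspaceT (@qform_continuous E)).
exists (qform E v0) => [|v].
  apply: pE; apply/eqP => v00; move: Sv0; rewrite /S /= v00 normr0 => /eqP.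
  by rewrite eq_sym oner_eq0.
have [->|vn0] := eqVneq v 0; first by rewrite qform0 normr0 expr0n mulr0.
have nv : `|v| != 0 by rewrite normr_eq0.
rewrite -[in leRHS](scale1r v) -(divff nv) -scalerA qformZ mulrC.
by rewrite ler_wpM2l ?sqr_ge0// minv0// inE; exact: unitS.
Qed.

(** Bounded entries bound the form of [E] by a multiple of [|v| ^+ 2], which the lower bound for [F]
    turns into a multiple of the form of [F]. *)
Lemma posdef_qnorm_bound E F : posdef F ->
  exists2 C : R, 0 < C & forall v, qnorm E v <= C * qnorm F v.
Proof.
move=> pF; have [l l0 lF] := posdef_lower_bound pF.
pose e := \sum_i \sum_j `|E i j|.
have e0 : 0 <= e by do 2!(apply: sumr_ge0 => ? _).
have Ee i j : `|E i j| <= e.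
  rewrite /e (bigD1 i)//= (bigD1 j)//= -addrA lerDl addr_ge0//.
    by apply: sumr_ge0.
  by do 2!(apply: sumr_ge0 => ? _).
pose C := 1 + n%:R ^+ 2 * e / l.
have C0 : 0 < C.
  by rewrite /C ltr_wpDr// divr_ge0 ?(ltW l0)// mulr_ge0// sqr_ge0.
exists (Num.sqrt C); first by rewrite sqrtr_gt0.
move=> v; rewrite /qnorm -sqrtrM ?(ltW C0)//; apply: ler_wsqrtr.
apply: le_trans (ler_norm _) _; apply: le_trans (ler_norm_qform v Ee) _.
apply: (@le_trans _ _ (n%:R ^+ 2 * e / l * qform F v)).
  by rewrite -[leRHS]mulrA ler_wpM2l ?mulr_ge0 ?sqr_ge0// ler_pdivlMl.
by rewrite ler_wpM2r ?posdef_ge0// lerDr.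
Qed.

Definition mx_continuous_at {T : topologicalType} {m p} (F : T -> 'M[R]_(m, p))
  (x : T) : Prop := forall i j, {for x, continuous (fun y => F y i j)}.

(** Entries close to those of [F x] change the form by at most a small fraction of itself, because
    the form of [F x] dominates [|w| ^+ 2]; hence one neighbourhood serves all [w]. *)
Lemma near_posdef_qnorm (T : topologicalType) (F : T -> 'M[R]_n) (x : T)
    (d : R) : mx_continuous_at F x -> posdef (F x) -> 1 < d ->
  \forall y \near x, forall w,
    qnorm (F y) w <= d * qnorm (F x) w /\ qnorm (F x) w <= d * qnorm (F y) w.
Proof.
move=> cF pF d1; have [l l0 lF] := posdef_lower_bound pF.
have d0 : 0 < d by apply: lt_trans d1.
have dd1 : 1 < d ^+ 2 by rewrite expr_gt1// ltW.
have dd0 : 0 < d ^+ 2 by apply: lt_trans dd1.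
(* Chosen so that [1 - e] is the inverse of [d ^+ 2]; then also [1 + e <= d ^+ 2], the difference
   being [(d ^+ 2 - 1) * e]. *)
pose e := 1 - (d ^+ 2)^-1.
have e0 : 0 < e by rewrite subr_gt0 invf_lt1.
pose N : R := n%:R ^+ 2 + 1.
have N0 : 0 < N by rewrite ltr_wpDl// sqr_ge0.
pose eta := e * l / N.
have eta0 : 0 < eta by rewrite divr_gt0// mulr_gt0.
have : \forall y \near x, forall i j, `|(F y - F x) i j| <= eta.
  apply: filter_forall => i; apply: filter_forall => j.
  have /cvgrPdist_le/(_ eta eta0) := cF i j.
  by apply: filterS => y; rewrite distrC !mxE.
apply: filterS => y Fy w.
have q0 := posdef_ge0 w pF.
have : `|qform (F y) w - qform (F x) w| <= e * qform (F x) w.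
  rewrite -qformB; apply: le_trans (ler_norm_qform w Fy) _.
  apply: (@le_trans _ _ (e * (l * `|w| ^+ 2))); last by rewrite ler_wpM2l// ltW.
  rewrite [leRHS]mulrA ler_wpM2r ?sqr_ge0// /eta mulrCA ger_pMr ?mulr_gt0//.
  by rewrite ler_pdivrMr// mul1r lerDl.
rewrite ler_distl => /andP[lo hi].
have qlo : qform (F x) w <= d ^+ 2 * qform (F y) w.
  rewrite -ler_pdivrMl//; apply: le_trans lo.
  by rewrite -[X in X - _]mul1r -mulrBl /e opprB addrC subrK.
have qhi : qform (F y) w <= d ^+ 2 * qform (F x) w.
  apply: (le_trans hi); rewrite -[X in X + _]mul1r -mulrDl ler_wpM2r//.
  rewrite -subr_ge0 (_ : _ - _ = (d ^+ 2 - 1) * e).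
    by rewrite mulr_ge0 ?(ltW e0)// subr_ge0 ltW.
  by rewrite /e; field; rewrite gt_eqF.
have dE : d = Num.sqrt (d ^+ 2) by rewrite sqrtr_sqr ger0_norm// ltW.
by split; rewrite /qnorm {1}dE -sqrtrM ?sqr_ge0//; exact: ler_wsqrtr.
Qed.

End QuadraticForms.

Lemma mx_continuous_at_mul (R : realType) (T : topologicalType) (m n p : nat)
    (F : T -> 'M[R]_(m, n)) (H : T -> 'M[R]_(n, p)) (x : T) :
  mx_continuous_at F x -> mx_continuous_at H x ->
  mx_continuous_at (fun y => F y *m H y) x.
Proof.
move=> cF cH i j.
rewrite (_ : (fun y => _) = fun y => \sum_k F y i k * H y k j); last first.
  by apply/funext => y; rewrite mxE.
by apply: continuous_for_sum => k; exact: continuousM (cF i k) (cH k j).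
Qed.

Lemma mx_continuous_at_tr (R : realType) (T : topologicalType) (m n : nat)
    (F : T -> 'M[R]_(m, n)) (x : T) :
  mx_continuous_at F x -> mx_continuous_at (fun y => (F y)^T) x.
Proof.
move=> cF i j; rewrite (_ : (fun y => _) = fun y => F y j i); first exact: cF.
by apply/funext => y; rewrite mxE.
Qed.

(** Covariance of a pulled-back inner product: two factorizations of one derivative, through a chart
    at the image and through one at the source, give the same Gram matrix. *)
Lemma congruence_mul (R : comPzRingType) (n : nat) (E J P Q T : 'M[R]_n) :
  J *m P = Q *m T ->
  J *m (P *m E *m P^T) *m J^T = Q *m (T *m E *m T^T) *m Q^T.
Proof.
by move=> e; rewrite !mulmxA e -mulmxA -trmx_mul e trmx_mul !mulmxA.
Qed.

(** * Continuous metric fields *)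

Section TensorFields.
Context {R : realType} {n : nat} {M : topologicalType}.
Variable A : smooth_manifold R n M.
Implicit Types (E F : M -> 'M[R]_n) (x y : M) (v w : 'rV[R]_n).

(* [chart_at] may jump from point to point, so components at [y] close to [x]
   are first moved to the fixed chart at [x]. *)
Definition transfer x y : 'M[R]_n := jac (chart_at A x) (chart_at A y) idfun y.

(** A merely continuous Riemannian metric. Continuity suffices for the comparisons below and, unlike
    smoothness, survives pullback by a C^2 local diffeomorphism. *)
Definition metric_field E : Prop :=
  (forall x, posdef (E x)) /\
  forall x, mx_continuous_at
    (fun y => transfer x y *m E y *m (transfer x y)^T) x.

Lemma transfer_unit x y : dom (chart_at A x) y -> transfer x y \in unitmx.
Proof.
move=> xy; have yy := dom_chart_at A y.
have nid : \forall z \near y, idfun (idfun z) = z by exact: nearW.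
have [u _] := mulmx1_unit
  (jac_left_inverse (dmap_id A y) (dmap_id A y) nid xy yy).
exact: u.
Qed.

(** The row [w] holds components in the fixed chart at [x]; in that chart the Gram matrices depend
    continuously on [y]. *)
Lemma near_metric_field E x (d : R) : metric_field E -> 1 < d ->
  \forall y \near x, forall w,
    qnorm (E y) (w *m transfer x y) <= d * qnorm (E x) (w *m transfer x x) /\
    qnorm (E x) (w *m transfer x x) <= d * qnorm (E y) (w *m transfer x y).
Proof.
move=> [pE cE] d1.
have pEx : posdef (transfer x x *m E x *m (transfer x x)^T).
  exact: posdef_mul (pE x) (transfer_unit (dom_chart_at A x)).
apply: filterS (near_posdef_qnorm (cE x) pEx d1) => y H w.
by rewrite !qnorm_mul.
Qed.

Lemma transfer_onto x y v : dom (chart_at A x) y ->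
  exists w, v = w *m transfer x y.
Proof.
move=> xy; exists (v *m invmx (transfer x y)).
by rewrite mulmxKV// transfer_unit.
Qed.

Lemma near_metric_field_le E F x : metric_field E -> metric_field F ->
  exists2 C : R, 0 < C &
    \forall y \near x, forall v, qnorm (E y) v <= C * qnorm (F y) v.
Proof.
move=> mE mF; have [C C0 EF] := posdef_qnorm_bound (E x) (mF.1 x).
have lt12 : 1 < 2 :> R by rewrite ltr1n.
(* Passing from [y] to [x] and back costs a factor 2 each time; [C] compares the two norms at
   [x]. *)
exists (2 * C * 2); first by rewrite !mulr_gt0.
have nE := near_metric_field x mE lt12; have nF := near_metric_field x mF lt12.
apply: filterS3 nE nF (near_dom (dom_chart_at A x)) => y Ey Fy xy v.
have [w ->] := transfer_onto v xy.
apply: le_trans (Ey w).1 _; rewrite -!mulrA ler_wpM2l//.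
by apply: le_trans (EF _) _; rewrite ler_wpM2l ?(ltW C0)//; exact: (Fy w).2.
Qed.

(** Local constants exist and may be enlarged, so by compactness one large [C] serves all points. *)
Lemma metric_field_le E F : compact [set: M] -> metric_field E ->
  metric_field F ->
  exists2 C : R, 0 < C & forall y v, qnorm (E y) v <= C * qnorm (F y) v.
Proof.
move=> cM mE mF.
have : \forall C \near +oo, [set: M] `<=`
    (fun y => forall v, qnorm (E y) v <= C * qnorm (F y) v).
  apply: (iffLR (compact_near_coveringP _) cM _ _
    (fun C y => forall v, qnorm (E y) v <= C * qnorm (F y) v)) => x _.
  have [C C0 Cx] := near_metric_field_le x mE mF.
  exists ([set y | forall v, qnorm (E y) v <= C * qnorm (F y) v],
          [set D | C <= D]).
    by split => //=; apply: nbhs_pinfty_ge; rewrite num_real.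
  move=> [y D] [/= yC CD] v; apply: le_trans (yC v) _.
  by rewrite ler_wpM2r ?qnorm_ge0.
move=> near_le; near (pinfty_nbhs R) => C; exists C => [//|y].
have : [set: M] `<=` (fun y => forall v, qnorm (E y) v <= C * qnorm (F y) v).
  by near: C.
exact.
Unshelve. all: by end_near. Qed.

(* [t x] is the norm of the identity from the norm of [F x] to that of [E x]. *)
Lemma continuous_ln_ratio E F (t : M -> R) : metric_field E ->
  metric_field F -> (forall x, 0 < t x) ->
  (forall x v, qnorm (E x) v <= t x * qnorm (F x) v) ->
  (forall x C, 0 <= C -> (forall v, qnorm (E x) v <= C * qnorm (F x) v) ->
    t x <= C) ->
  continuous (@ln R \o t).
Proof.
move=> mE mF t0 tle let_ x; apply/cvgrPdist_le => e e0 /=.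
(* Two comparisons, one for each field, cost a factor [d] each, and [ln (d * d)] is [e]. *)
pose d := expR (e / 2).
have d0 : 0 < d by exact: expR_gt0.
have d1 : 1 < d by rewrite expR_gt1 divr_gt0.
have dd : ln (d * d) = e by rewrite lnM ?posrE// expRK -splitr.
have nE := near_metric_field x mE d1; have nF := near_metric_field x mF d1.
apply: filterS3 nE nF (near_dom (dom_chart_at A x)) => y Ey Fy xy.
have yx : t y <= d * d * t x.
  apply: let_ => [|v]; first by rewrite !mulr_ge0// ltW.
  have [w ->] := transfer_onto v xy.
  apply: le_trans (Ey w).1 _; rewrite -!mulrA ler_wpM2l ?(ltW d0)//.
  apply: le_trans (tle _ _) _; rewrite mulrCA ler_wpM2l ?(ltW (t0 _))//.
  exact: (Fy w).2.
have {}xy : t x <= d * d * t y.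
  apply: let_ => [|v]; first by rewrite !mulr_ge0// ltW.
  have [w ->] := transfer_onto v (dom_chart_at A x).
  apply: le_trans (Ey w).2 _; rewrite -!mulrA ler_wpM2l ?(ltW d0)//.
  apply: le_trans (tle _ _) _; rewrite mulrCA ler_wpM2l ?(ltW (t0 _))//.
  exact: (Fy w).1.
rewrite -dd ler_distlC; apply/andP; split.
  rewrite lerBlDl -lnM ?posrE ?mulr_gt0//.
  by rewrite ler_ln ?posrE ?mulr_gt0.
by rewrite addrC -lnM ?posrE ?mulr_gt0// ler_ln ?posrE ?mulr_gt0.
Qed.

Lemma metric_field_gram (G : riemannian_metric A) : metric_field (gram G).
Proof.
split=> [x v v0|x i j]; first exact: gram_gt0.
pose a := chart_at A x; have ax : dom a x by exact: dom_chart_at.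
(* The components that [gram_smooth] speaks of, in the chart at [x]; its case [k = 0] gives their
   continuity. *)
pose H (u : 'rV[R]_n) : 'M[R]_n := let z := param a u in
  let J := 'J (Defs.coord (chart_at A z) \o param a) u in J *m gram G z *m J^T.
apply: (@near_eq_continuous_for _ _ (fun y => H (Defs.coord a y) i j)).
  apply: filterS (near_dom ax) => y ay.
  by rewrite /H /= coordK.
apply: (@continuous_comp _ _ _ (Defs.coord a) (fun u => H u i j)).
  exact: Defs.coord_continuous.
apply: (@continuous_comp _ _ _ H (fun N : 'M[R]_n => N i j)).
  by apply: (gram_smooth G a 0); exact: imageP.
exact: coord_continuous.
Qed.

Lemma tangent_comp f h x : dmap A f x -> dmap A h (f x) ->
  tangent A (h \o f) x = tangent A f x *m tangent A h (f x).
Proof. by move=> df dh; apply: jac_comp df dh _ _ _; exact: dom_chart_at. Qed.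

Lemma tangent_unit k (g : M -> M) x : Ck_local_diffeo A k.+1 g ->
  tangent A g x \in unitmx.
Proof.
move=> dg; have [h dh hg] := Ck_local_diffeo_inverse x dg.
have [u _] := mulmx1_unit (jac_left_inverse (Ck_local_diffeo_dmap x dg) dh hg
  (dom_chart_at A x) (dom_chart_at A (g x))).
exact: u.
Qed.

(** In fixed charts around [x] and [g x] the pullback is the product of the Jacobian of [g], the
    components of [E] along [g] and the transposed Jacobian, all continuous. *)
Lemma metric_field_pullback k (g : M -> M) E : Ck_local_diffeo A k.+2 g ->
  metric_field E ->
  metric_field (fun x => tangent A g x *m E (g x) *m (tangent A g x)^T).
Proof.
move=> dg [pE cE]; split => [x|x].
  exact: posdef_mul (pE _) (tangent_unit x dg).
pose a := chart_at A x; pose b := chart_at A (g x).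
have ax : dom a x by exact: dom_chart_at.
have bgx : dom b (g x) by exact: dom_chart_at.
have dgy y := Ck_local_diffeo_dmap y dg.
have cg : {for x, continuous g} := (dgy x).1.
pose P y := transfer (g x) (g y).
have cJ : mx_continuous_at (jac a b g) x.
  by move=> i j; exact: Ck_local_diffeo_jac_continuous dg ax bgx.
have cP : mx_continuous_at (fun y => P y *m E (g y) *m (P y)^T) x.
  move=> i j; apply: (@continuous_comp _ _ _ g (fun z =>
    (transfer (g x) z *m E z *m (transfer (g x) z)^T) i j)) => //.
  exact: cE.
have cH := mx_continuous_at_mul (mx_continuous_at_mul cJ cP)
  (mx_continuous_at_tr cJ).
move=> i j; apply: near_eq_continuous_for (cH i j).
have bg : \forall y \near x, dom b (g y) by exact: cg _ (near_dom bgx).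
apply: filterS2 (near_dom ax) bg => y ay bgy.
(* Both sides are the Jacobian of [g] from the chart [a] to the preferred chart at [g y], factored
   through [b] at the image or through the preferred chart at [y]. *)
have JP : jac a b g y *m P y = transfer x y *m tangent A g y.
  have cgy := dom_chart_at A (g y); have cy := dom_chart_at A y.
  have e1 : jac a (chart_at A (g y)) g y = jac a b g y *m P y :=
    jac_comp (dgy y) (dmap_id A (g y)) ay bgy cgy.
  have e2 : jac a (chart_at A (g y)) g y = transfer x y *m tangent A g y :=
    jac_comp (dmap_id A y) (dgy y) ay cy cgy.
  by apply: etrans (esym e1) e2.
exact: (congr1 (fun N : 'M[R]_n => N i j) (congruence_mul (E (g y)) JP)).
Qed.

End TensorFields.

(** * The operator norm of the inverse derivative *)

Section Topnorm.
Context {R : realType} {n : nat} {M : topologicalType}.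
Variables (A : smooth_manifold R n M) (G : riemannian_metric A).
Implicit Types (x y : M) (v w : 'rV[R]_n) (B : 'M[R]_n).

Lemma gram_posdef x : posdef (gram G x).
Proof. by move=> v v0; exact: gram_gt0. Qed.

Lemma tnorm_gt0 x v : v != 0 -> 0 < tnorm G x v.
Proof. by move=> v0; apply: posdef_qnorm_gt0 v0; exact: gram_posdef. Qed.

Lemma tnorm_le_topnorm x y B v :
  tnorm G y (v *m B) <= topnorm G x y B * tnorm G x v.
Proof.
have [C C0 BC] :=
  posdef_qnorm_bound (B *m gram G y *m B^T) (gram_posdef x).
pose S := [set tnorm G y (w *m B) | w in [set w | tnorm G x w <= 1]].
(* The supremum of an unbounded set would be a default value, so the image of the unit ball is
   bounded first. *)
have ubS : has_ubound S.
  exists C => _ [w /= w1 <-]; apply: le_trans (_ : C * tnorm G x w <= _).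
    by rewrite -[leLHS]/(qnorm _ _) qnorm_mul; exact: BC.
  by rewrite ger_pMr.
have [->|v0] := eqVneq v 0.
  rewrite mul0mx -![tnorm _ _ 0]/(qnorm _ 0) !qnorm0; lra.
have nv := tnorm_gt0 x v0.
rewrite -ler_pdivrMr// -[topnorm _ _ _ _]/(sup S).
apply: (ub_le_sup ubS); exists ((tnorm G x v)^-1 *: v) => /=.
  rewrite -[leLHS]/(qnorm _ _) qnormZ normfV gtr0_norm//.
  by rewrite -[qnorm _ _]/(tnorm G x v) mulVf ?gt_eqF.
rewrite -scalemxAl -[LHS]/(qnorm _ _) qnormZ normfV gtr0_norm// mulrC.
by [].
Qed.

Lemma topnorm_le x y B (C : R) : 0 <= C ->
  (forall v, tnorm G y (v *m B) <= C * tnorm G x v) -> topnorm G x y B <= C.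
Proof.
move=> C0 BC; apply: ge_sup.
  exists (tnorm G y (0 *m B)), 0 => //=.
  by rewrite -[leLHS]/(qnorm _ 0) qnorm0.
by move=> _ [w /= w1 <-]; apply: le_trans (BC w) _; rewrite ler_piMr.
Qed.

Lemma topnorm_gt0 x y B : (0 < n)%N -> B \in unitmx -> 0 < topnorm G x y B.
Proof.
move=> n0 uB; pose v : 'rV[R]_n := const_mx 1.
have v0 : v != 0.
  apply/eqP => /matrixP/(_ 0 (Ordinal n0)); rewrite !mxE => /eqP.
  by rewrite oner_eq0.
have vB0 : v *m B != 0.
  by apply: contraNneq v0 => vB0; rewrite -(mulmxK uB v) vB0 mul0mx.
have := lt_le_trans (tnorm_gt0 y vB0) (tnorm_le_topnorm x y B v).
by rewrite pmulr_lgt0// tnorm_gt0.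
Qed.

(** In positive dimension, minus the logarithm of the conorm of Dg at [x], the least factor by which
    it stretches a tangent vector; negative values mean expansion. *)
Definition log_conorm (g : M -> M) x : R :=
  ln (topnorm G (g x) x (invmx (tangent A g x))).

Lemma log_conorm_continuous k (g : M -> M) : (0 < n)%N ->
  Ck_local_diffeo A k.+2 g -> continuous (log_conorm g).
Proof.
(* The norm of the inverse of Dg is that of the identity from the pullback of
   the metric to the metric, so no inverse has to be shown continuous. *)
move=> n0 dg; have mG := metric_field_gram G.
have uT x : tangent A g x \in unitmx := tangent_unit x dg.
pose t x := topnorm G (g x) x (invmx (tangent A g x)).
apply: (@continuous_ln_ratio _ _ _ _ _ _ t mG (metric_field_pullback dg mG)).
- by move=> x; apply: topnorm_gt0 n0 _; rewrite unitmx_inv.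
- move=> x v; rewrite -qnorm_mul -{1}(mulmxK (uT x) v).
  exact: tnorm_le_topnorm.
move=> x C C0 H; apply: (topnorm_le C0) => v.
have := H (v *m invmx (tangent A g x)).
by rewrite -qnorm_mul mulmxKV.
Qed.

Lemma iter_dmap k (g : M -> M) x : (forall y, dmap A g y) ->
  dmap A (iter k g) x.
Proof.
move=> dg; elim: k => [|k IH]; first exact: dmap_id.
exact: (dmap_comp IH (dg _)).
Qed.

Lemma tangent_id x : tangent A idfun x = 1%:M.
Proof. exact: jac_id (dom_chart_at A x). Qed.

Lemma tnorm_le_log_conorm k (g : M -> M) x v : (0 < n)%N ->
  Ck_local_diffeo A k.+1 g ->
  tnorm G x v <= expR (log_conorm g x) * tnorm G (g x) (v *m tangent A g x).
Proof.
move=> n0 dg; have uT : tangent A g x \in unitmx := tangent_unit x dg.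
have t0 : 0 < topnorm G (g x) x (invmx (tangent A g x)).
  by apply: topnorm_gt0 n0 _; rewrite unitmx_inv.
rewrite /log_conorm lnK ?posrE// -{1}(mulmxK uT v).
exact: tnorm_le_topnorm.
Qed.

Lemma tangent_iterS k (g : M -> M) x : (forall y, dmap A g y) ->
  tangent A (iter k.+1 g) x =
  tangent A (iter k g) x *m tangent A g (iter k g x).
Proof. by move=> dg; exact: (tangent_comp (iter_dmap k x dg) (dg _)). Qed.

(** One step costs the exponential of [log_conorm], since a vector is the inverse derivative of its
    own image; the chain rule multiplies these factors along the orbit. *)
Lemma tnorm_le_iter j k (g : M -> M) x v : (0 < n)%N ->
  Ck_local_diffeo A j.+1 g ->
  tnorm G x v <= expR (\sum_(0 <= i < k) log_conorm g (iter i g x)) *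
                 tnorm G (iter k g x) (v *m tangent A (iter k g) x).
Proof.
move=> n0 dg; have dmg y := Ck_local_diffeo_dmap y dg.
elim: k => [|k IH].
  by rewrite big_nil expR0 mul1r tangent_id mulmx1.
have e : v *m tangent A (iter k.+1 g) x =
    v *m tangent A (iter k g) x *m tangent A g (iter k g x).
  exact: etrans (congr1 (mulmx v) (tangent_iterS k x dmg)) (mulmxA _ _ _).
have eS := etrans (congr1 expR (big_nat_recr k 0
  (fun i => log_conorm g (iter i g x)) (leq0n k))) (expRD _ _).
rewrite {}e {}eS -[leRHS]mulrA; apply: le_trans IH _.
apply: ler_wpM2l; first exact: expR_ge0.
exact: tnorm_le_log_conorm.
Qed.

End Topnorm.

(** * Birkhoff sums *)

(** Heine-Cantor: continuity at [x] on a ball of radius [r] controls all pairs at distance below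
    [r / 2] whose first point lies within [r / 2] of [x]. *)
Lemma compact_unif_continuous (R : realType) (M : metricType R) (f : M -> R)
    (e : R) : compact [set: M] -> continuous f -> 0 < e ->
  exists2 d : R, 0 < d & forall x y, mdist x y < d -> `|f x - f y| <= e.
Proof.
move=> cM cf e0.
have : \forall d \near 0^'+, [set: M] `<=`
    (fun x => forall y, mdist x y < d -> `|f x - f y| <= e).
  apply: (iffLR (compact_near_coveringP _) cM _ _
    (fun d x => forall y, mdist x y < d -> `|f x - f y| <= e)) => x _.
  have e20 : 0 < e / 2 by rewrite divr_gt0.
  have /cvgrPdist_le/(_ _ e20)/nbhs_ballP[r /= r0 fr] := cf x.
  have {}fr y : mdist x y < r -> `|f x - f y| <= e / 2.
    by move=> xy; apply: fr; rewrite ballEmdist.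
  have r20 : 0 < r / 2 by rewrite divr_gt0.
  exists ([set y | mdist x y < r / 2], [set d | d < r / 2]).
    split => /=; last exact: nbhs_right_lt.
    by apply/nbhs_ballP; exists (r / 2) => //= y; rewrite ballEmdist.
  move=> [y d] [/= xy dr] z yz.
  have xz : mdist x z < r.
    apply: le_lt_trans (metric_triangle x y z) _.
    by rewrite [ltRHS]splitr ltrD// (lt_trans yz).
  have {}xy : mdist x y < r by apply: lt_trans xy _; lra.
  rewrite [leRHS]splitr; apply: le_trans (ler_distD (f x) _ _) _.
  by rewrite lerD ?fr// distrC fr.
move=> near_d; near (0 : R)^'+ => d; exists d => [//|x y].
have : [set: M] `<=` (fun x => forall y, mdist x y < d -> `|f x - f y| <= e).
  by near: d.
by apply.
Unshelve. all: by end_near. Qed.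

Lemma compact_finite_cells (R : realType) (M : metricType R) (L : set M)
    (a : R) : compact L -> 0 < a ->
  exists (N : nat) (cell : M -> nat), (forall x, L x -> (cell x < N)%N) /\
    forall x y, L x -> L y -> cell x = cell y -> mdist x y < a.
Proof.
move=> cL a0; have a20 : 0 < a / 2 by rewrite divr_gt0.
(* Finite lists of centres, directed by inclusion: a covering that holds eventually along this
   filter holds for a single finite list. *)
pose F := filter_from [set: seq M] (fun t => [set s : seq M | {subset t <= s}]).
have FF : Filter F.
  apply: filter_from_filter; first by exists [::].
  move=> t1 t2 _ _; exists (t1 ++ t2) => // s /= ts.
  by split=> z zt; apply: ts; rewrite mem_cat zt ?orbT.
have : \near F, L `<=` (fun x => exists2 z : M, z \in F & mdist z x < a / 2).
  apply: (iffLR (compact_near_coveringP _) cL _ F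
    (fun s x => exists2 z : M, z \in s & mdist z x < a / 2) FF) => x _.
  exists ([set y | mdist x y < a / 2], [set s : seq M | x \in s]).
    split=> /=.
      by apply/nbhs_ballP; exists (a / 2) => //= y; rewrite ballEmdist.
    by exists [:: x] => // s /=; apply; rewrite inE.
  by move=> [y s] [/= xy xs]; exists x.
case=> s _ /(_ s (fun _ => id)) /= Ls.
pose near_pt x : pred M := fun z => mdist z x < a / 2.
have hs x : L x -> has (near_pt x) s.
  by move=> /Ls[z zs zx]; apply/hasP; exists z.
(* The cell of [x] is the index of the first listed centre within [a / 2] of it; two points of one
   cell share that centre. *)
exists (size s), (fun x => find (near_pt x) s); split.
  by move=> x /hs; rewrite has_find.
move=> x y Lx Ly xy.
have := nth_find x (hs _ Lx); have := nth_find x (hs _ Ly).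
rewrite -xy /near_pt; set z := nth x s _ => zy zx.
apply: le_lt_trans (metric_triangle x z y) _.
by rewrite [ltRHS]splitr ltrD// metric_sym.
Qed.

(* Cut the segment at the last visit of the cell of its first point: the loop
   contributes at most 0, one further step at most B, and that cell is never
   visited again. *)
Lemma sum_le_of_loops (R : realType) (f : nat -> R) (u : nat -> nat) (B : R) :
  0 <= B -> (forall i, f i <= B) ->
  (forall i j, (i < j)%N -> u i = u j -> \sum_(i <= l < j) f l <= 0) ->
  forall (s : seq nat) (m k : nat),
    (forall l, (m <= l < k)%N -> u l \in s) ->
    \sum_(m <= l < k) f l <= (size s)%:R * B.
Proof.
move=> B0 fB loop s; have [N] := ubnP (size s).
elim: N s => // N IH s sN m k us.
have [km|mk] := leqP k m; first by rewrite big_geq// mulr_ge0.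
have ums : u m \in s by apply: us; rewrite leqnn.
pose P j := (m <= j < k)%N && (u j == u m).
have exP : exists j, P j by exists m; rewrite /P leqnn mk eqxx.
have boundP j : P j -> (j <= k)%N by case/andP => /andP[_ /ltnW].
case: (ex_maxnP exP boundP) => j /andP[/andP[mj jk] /eqP uj] maxj.
rewrite (@big_cat_nat _ _ _ j)//=; last exact: ltnW.
rewrite [X in _ + X]big_ltn//.
have le0 : \sum_(m <= l < j) f l <= 0.
  have [->|nmj] := eqVneq m j; first by rewrite big_geq.
  by apply: loop; rewrite ?uj// ltn_neqAle nmj.
have s0 : (0 < size s)%N by case: (s) ums.
have ler : \sum_(j.+1 <= l < k) f l <= (size s).-1%:R * B.
  rewrite -(size_rem ums); apply: IH.
    by rewrite size_rem// prednK.
  move=> l /andP[jl lk]; have ml : (m <= l)%N by rewrite (leq_trans mj)// ltnW.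
  have ulm : u l != u m.
    apply: contraTneq jl => ulm; rewrite -leqNgt; apply: maxj.
    by rewrite /P ml lk ulm eqxx.
  move: (us l); rewrite ml lk => /(_ isT).
  by rewrite (perm_mem (perm_to_rem ums)) inE (negbTE ulm).
apply: le_trans (lerD le0 (lerD (fB j) ler)) _.
by rewrite add0r -{2}(prednK s0) -natr1 mulrDl mul1r addrC.
Qed.

(** Averages of a periodic sequence tend to its mean over a period: a sum of length [m] differs from
    [m] times that mean by a periodic, hence bounded, amount. So the mean [a] cannot exceed
    [eta]. *)
Lemma periodic_sum_le (R : realType) (f : nat -> R) (k : nat) (eta : R) :
  (0 < k)%N -> (forall j, f (j + k)%N = f j) ->
  (limn_einf (fun m => ((m%:R^-1 * \sum_(0 <= j < m) f j)%:E : \bar R))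
    <= eta%:E)%E ->
  \sum_(0 <= j < k) f j <= k%:R * eta.
Proof.
move=> k0 fk; apply: contraTT; rewrite -ltNge -ltNge => eta_lt.
have k0R : 0 < k%:R :> R by rewrite ltr0n.
set S := \sum_(0 <= j < k) f j in eta_lt.
pose a := S / k%:R; have eta_a : eta < a by rewrite ltr_pdivlMr// mulrC.
pose h m := \sum_(0 <= j < m) f j - m%:R * a.
have hk m : h (m + k)%N = h m.
  rewrite /h (@big_cat_nat _ _ _ k)//=; last exact: leq_addl.
  have -> : \sum_(k <= j < m + k) f j = \sum_(0 <= j < m) f j.
    by rewrite -{1}(add0n k) big_addn addnK; apply: eq_bigr.
  by rewrite -/S natrD mulrDl /a [k%:R * _]mulrC divfK ?gt_eqF//; ring.
have hmod m : h m = h (m %% k)%N.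
  rewrite {1}(divn_eq m k) addnC; elim: (m %/ k)%N => [|q IH].
    by rewrite mul0n addn0.
  by rewrite mulSn [(k + _)%N]addnC addnA hk.
pose C := \sum_(i < k) `|h i|.
have hC m : - C <= h m.
  rewrite lerNl hmod; apply: le_trans (ler_norm _) _; rewrite normrN.
  rewrite /C (bigD1 (Ordinal (ltn_pmod m k0)))//= lerDl.
  by apply: sumr_ge0.
have C0 : 0 <= C by apply: sumr_ge0.
(* The midpoint of [eta] and [a]: the averages stay above it from [N] on, where [C / q < a - b]. *)
pose b := (a + eta) / 2.
apply: (@lt_le_trans _ _ b%:E); first by rewrite lte_fin /b; lra.
rewrite limn_einf_lim; apply: lime_ge; first exact: is_cvg_einfs.
pose N := (Num.truncn (C / (a - b))).+1.
have ab : 0 < a - b by rewrite /b; lra.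
exists N => // m /= Nm; apply: le_ereal_inf_tmp => _ [q /= mq <-].
have q0 : 0 < q%:R :> R by rewrite ltr0n (leq_trans _ mq)// (leq_trans _ Nm).
rewrite lee_fin mulrC ler_pdivlMr//.
have : C / (a - b) < q%:R.
  by apply: lt_le_trans (truncnS_gt _) _; rewrite ler_nat (leq_trans Nm).
rewrite ltr_pdivrMr//; have := hC q; rewrite /h; lra.
Qed.

Lemma periodic_shadowing_sum_le (R : realType) (M : metricType R) (g : M -> M)
    (L : set M) (phi : M -> R) (eta : R) :
  compact [set: M] -> compact L -> g @` L `<=` L -> periodic_shadowing g L ->
  continuous phi -> eta < 0 ->
  (forall p k, (0 < k)%N -> iter k g p = p ->
    \sum_(0 <= j < k) phi (iter j g p) <= k%:R * eta) ->
  exists K : R, forall x k, L x ->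
    \sum_(0 <= j < k) phi (iter j g x) <= K + k%:R * (eta / 2).
Proof.
move=> cM cL gL shadow cphi eta0 per.
(* Half of the decay per step is given up as tolerance when an orbit is replaced by its shadow. *)
have e0 : 0 < - (eta / 2) by rewrite oppr_gt0; lra.
have [d d0 phid] := compact_unif_continuous cM cphi e0.
have [a a0 shadow_a] := shadow d d0.
have Liter x j : L x -> L (iter j g x).
  by move=> Lx; elim: j => //= j IH; apply: gL; exists (iter j g x).
have loop x k : L x -> (0 < k)%N -> mdist (iter k g x) x < a ->
    \sum_(0 <= j < k) phi (iter j g x) <= k%:R * (eta / 2).
  move=> Lx k0 ka.
  have [p pp px] := shadow_a x k k0 (fun j _ => Liter x j Lx) ka.
  have -> : k%:R * (eta / 2) =
      k%:R * eta + \sum_(0 <= j < k) - (eta / 2).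
    rewrite sumr_const_nat subn0 -[X in _ = _ + X]mulr_natl -mulrDr.
    by congr (_ * _); lra.
  apply: le_trans (lerD (per p k k0 pp) (lexx _)).
  rewrite -big_split /= !big_mkord.
  apply: ler_sum => j _; rewrite -lerBlDl; apply: le_trans (ler_norm _) _.
  by rewrite distrC; apply: phid; apply: px; exact: ltnW.
have [N [cell [cellN cella]]] := compact_finite_cells cL a0.
have [B phiB] : exists B, forall x, phi x <= B.
  have [M0|/nonemptyPn M0] := pselect ([set: M] !=set0); last first.
    exists 0 => x; suff : [set: M] x by rewrite M0.
    by [].
  have [c _ cmax] := compact_EVT_max M0 cM (continuous_subspaceT cphi).
  by exists (phi c) => x; apply: cmax; rewrite inE.
pose B' := `|B - eta / 2|.
exists (N%:R * B') => x k Lx.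
(* Subtracting [eta / 2] per step turns the bound on loops into nonpositive sums. *)
pose f j := phi (iter j g x) - eta / 2.
have fB j : f j <= B' by apply: le_trans (ler_norm _); rewrite lerB.
have floop i j : (i < j)%N -> cell (iter i g x) = cell (iter j g x) ->
    \sum_(i <= l < j) f l <= 0.
  move=> ij cij; rewrite -{1}(add0n i) big_addn.
  have k0 : (0 < j - i)%N by rewrite subn_gt0.
  have := loop (iter i g x) (j - i)%N (Liter _ _ Lx) k0.
  rewrite -iterD subnK ?(ltnW ij)// metric_sym.
  move=> /(_ (cella _ _ (Liter _ _ Lx) (Liter _ _ Lx) cij)) loopij.
  rewrite /f sumrB sumr_const_nat subn0 subr_le0 -[leRHS]mulr_natl.
  by move: loopij; under eq_bigr do rewrite -iterD.
have := @sum_le_of_loops _ f (fun j => cell (iter j g x)) B' (normr_ge0 _)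
  fB floop (iota 0 N) 0 k.
have incell l : (0 <= l < k)%N -> cell (iter l g x) \in iota 0 N.
  by move=> _; rewrite mem_iota add0n; exact/cellN/Liter.
move=> /(_ incell); rewrite size_iota /f sumrB sumr_const_nat subn0.
by rewrite lerBlDr -[X in _ <= _ + X]mulr_natl.
Qed.

(** * From periodic orbits to uniform expansion *)

(** In positive dimension the operator norms are positive, so [lne] agrees with [ln] and the
    averages are real; [k] may be any return time, not only the least period. *)
Lemma non_uniformly_expanding_periodic_sum (R : realType) (n : nat)
    (M : topologicalType) (A : smooth_manifold R n M)
    (G : riemannian_metric A) (g : M -> M) (eta : R) (p : M) (k j : nat) :
  (0 < n)%N -> Ck_local_diffeo A j.+1 g -> (0 < k)%N -> iter k g p = p ->
  (limn_einf (fun k : nat =>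
     (k%:R^-1)%:E * \sum_(0 <= j < k)
       lne (topnorm G (g (iter j g p)) (iter j g p)
              (invmx (tangent A g (iter j g p))))%:E) <= eta%:E)%E ->
  \sum_(0 <= j < k) log_conorm G g (iter j g p) <= k%:R * eta.
Proof.
move=> n0 dg k0 pp le_eta.
have fk i : log_conorm G g (iter (i + k) g p) = log_conorm G g (iter i g p).
  by rewrite iterD pp.
apply: (@periodic_sum_le _ (fun j => log_conorm G g (iter j g p)) _ _ k0 fk).
have lneE i : (log_conorm G g (iter i g p))%:E =
    lne (topnorm G (g (iter i g p)) (iter i g p)
           (invmx (tangent A g (iter i g p))))%:E.
  apply/esym/lne_EFin/(topnorm_gt0 G _ _ n0).
  by rewrite unitmx_inv; exact: tangent_unit dg.
rewrite (_ : (fun m => _) = (fun m : nat => (m%:R^-1)%:E * \sum_(0 <= i < m)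
    (log_conorm G g (iter i g p))%:E)%E).
  by under eq_fun do under eq_bigr do rewrite lneE.
by apply/funext => m; rewrite sumEFin -EFinM.
Qed.

Theorem theorem4 (R : realType) (n : nat) (M : metricType R)
  (A : smooth_manifold R n M) (G : riemannian_metric A)
  (g : M -> M) (L : set M) :
  compact [set: M] ->
  Ck_local_diffeo A 2 g ->
  compact L ->
  g @` L `<=` L ->
  periodic_shadowing g L ->
  non_uniformly_expanding A g (periodic_points g) ->
  expanding_on G g L.
Proof.
move=> cM dg cL gL shadow [eta [G' [eta0 nue]]].
have [n0|n0] := posnP n.
  (* In dimension 0 all tangent vectors vanish, so any admissible constants will do. *)
  have v0 (v : 'rV[R]_n) : v = 0.
    by apply/matrixP => i j; have := ltn_ord j; rewrite {2}n0.
  exists 1, 2; rewrite ltr01 ltr1n; split=> // x _ v k.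
  rewrite (v0 v) (v0 (_ *m _)) -![tnorm _ _ 0]/(qnorm _ 0) !qnorm0.
  by rewrite mulr0.
have per p k : (0 < k)%N -> iter k g p = p ->
    \sum_(0 <= j < k) log_conorm G' g (iter j g p) <= k%:R * eta.
  move=> k0 pp; have np := nue p (ex_intro2 _ _ k k0 pp).
  exact: non_uniformly_expanding_periodic_sum n0 dg k0 pp np.
have [K SK] := periodic_shadowing_sum_le cM cL gL shadow
  (log_conorm_continuous (G:=G') n0 dg) eta0 per.
(* The adapted metric [G'] need not be [G], so norms are exchanged at both ends of the orbit. *)
have [C C0 GG'] := metric_field_le cM (metric_field_gram G)
  (metric_field_gram G').
have [C' C'0 G'G] := metric_field_le cM (metric_field_gram G')
  (metric_field_gram G).
pose s := expR (- (eta / 2)).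
have s0 : 0 < s by exact: expR_gt0.
(* The total loss: change of metric at [x], the additive constant [K], change of metric at the
   image. *)
pose c := C * expR K * C'.
have c0 : 0 < c by rewrite !mulr_gt0// expR_gt0.
exists c^-1, s; split; first by rewrite invr_gt0.
  by rewrite /s expR_gt1 oppr_gt0; lra.
move=> x Lx v k; rewrite -mulrA ler_pdivrMl//.
have sk : s ^+ k * expR (k%:R * (eta / 2)) = 1.
  by rewrite /s -expRM_natl -expRD -[X in expR X]/(_ + _) mulrN addNr expR0.
pose w := v *m tangent A (iter k g) x.
have h1 : tnorm G x v <= C * tnorm G' x v := GG' x v.
have h2 : tnorm G' x v <=
    expR K * expR (k%:R * (eta / 2)) * tnorm G' (iter k g x) w.
  apply: le_trans (tnorm_le_iter G' k x v n0 dg) _.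
  by rewrite ler_wpM2r ?sqrtr_ge0// -expRD ler_expR SK.
have h3 : tnorm G' (iter k g x) w <= C' * tnorm G (iter k g x) w := G'G _ w.
have -> : c * tnorm G (iter k g x) w = s ^+ k * (C * (expR K *
    expR (k%:R * (eta / 2)) * (C' * tnorm G (iter k g x) w))).
  rewrite /c -[LHS]mul1r -[in LHS]sk; ring.
rewrite ler_wpM2l ?exprn_ge0 ?(ltW s0)//; apply: le_trans h1 _.
rewrite ler_wpM2l ?(ltW C0)//; apply: le_trans h2 _.
by rewrite ler_wpM2l ?mulr_ge0 ?expR_ge0.
Qed.
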